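(* For every prime power $q$ and integer $n \ge 1$, there exists a left (resp. right) $M_n(\mathbb{F}_q)$-module $M$ such that the covering number of $M$ by left (resp. right) $M_n(\mathbb{F}_q)$-submodules is $\frac{q^{n+1}-1}{q-1}$.
   Context: $M_n(\mathbb{F}_q)$ is the ring of $n\times n$ matrices over the finite field $\mathbb{F}_q$ of order $q$. The covering number of a module $M$ by submodules is the minimum cardinality of a collection of proper submodules of $M$ whose set-theoretic union is $M$. *)

(* Defs.v *)
From mathcomp Require Import all_boot all_order all_algebra.
From mathcomp Require Import boolp classical_sets functions cardinality.

Set Implicit Arguments.
Unset Strict Implicit.
Unset Printing Implicit Defensive.

Local Open Scope classical_set_scope.
Local Open Scope card_scope.
Local Open Scope ring_scope.

(* A left R-module is an lmodType over R; a right R-module is an lmodType over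
   the converse ring R^c, with the right action x r given by r *: x. *)

Definition proper_submodule (R : pzRingType) (M : lmodType R) (N : set M) :
    Prop :=
  submod_closed [in N] /\ N <> setT.

Definition covering (R : pzRingType) (M : lmodType R) (C : set (set M)) :
    Prop :=
  (forall N, C N -> proper_submodule N) /\ \bigcup_(N in C) N = setT.

(* Collections of arbitrary cardinality compete for the minimum; `I_k is the
   set of natural numbers less than k. *)
Definition covering_number_is (R : pzRingType) (M : lmodType R) (k : nat) :
    Prop :=
  (exists C : set (set M), covering C /\ C #= `I_k) /\
  (forall C : set (set M), covering C -> `I_k #<= C).

Definition prime_power (q : nat) : Prop :=
  exists p e : nat, prime p /\ (0 < e)%N /\ q = (p ^ e)%N.

(* Main.v *)
Require Import Defs.
From HB Require Import structures.
From mathcomp Require Import all_boot all_order all_algebra.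
From mathcomp Require Import boolp classical_sets functions cardinality.

(** The left module is the space of n x (n+1) matrices over F.  The row space
    of such a matrix A has dimension at most n, hence lies in a hyperplane of
    F^(n+1); and the matrices whose rows lie in a fixed hyperplane form a
    proper submodule.  So the hyperplanes give a cover.  Conversely, a matrix
    whose row space is exactly the hyperplane H generates all matrices with
    rows in H, and two distinct hyperplanes span F^(n+1); a proper submodule
    therefore contains the chosen generator of at most one hyperplane, and any
    cover has at least as many members as there are hyperplanes.  This
    counting argument is [covering_number_of_transversal]; the hyperplanes are
    handled through the lines orthogonal to them, and [card_lines] counts
    these.

    The right module is the same space seen through transposition, an
    isomorphism between the matrix ring and its converse: restriction of
    scalars along a surjective ring morphism does not change which subsets are
    submodules ([covering_number_restrict_scalars]). *)

Set Implicit Arguments.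
Unset Strict Implicit.
Unset Printing Implicit Defensive.

Import GRing.Theory.
Local Open Scope classical_set_scope.
Local Open Scope card_scope.
Local Open Scope ring_scope.

(** * Covers of a module *)

Lemma card_setT_finType (T : finType) : `I_#|T| #= [set: T].
Proof.
rewrite (card_eql card_II) card_eq_sym.
have <- : [set (enum_val i : T) | i in [set: 'I_#|T|]] = [set: T].
  by apply/seteqP; split=> // x _; exists (enum_rank x); rewrite ?enum_rankK.
by apply: inj_card_eq => i j _ _; apply: enum_val_inj.
Qed.

(** The elements [x t] force distinct members of any cover, so a cover indexed
    by the same finite type is a smallest one; injectivity of [N] comes for
    free, since [N t = N t'] would contain both [x t] and [x t']. *)
Lemma covering_number_of_transversal (R : pzRingType) (M : lmodType R)
    (T : finType) (N : T -> set M) (x : T -> M) :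
    (forall t, proper_submodule (N t)) ->
    (forall m, exists t, N t m) ->
    (forall t, N t (x t)) ->
    (forall S : set M, proper_submodule S ->
       forall t t', S (x t) -> S (x t') -> t = t') ->
  covering_number_is M #|T|.
Proof.
move=> Nproper Ncover Nx sep; split.
- exists (range N); split; first split.
  + by move=> _ [t _ <-].
  + apply/seteqP; split=> // m _.
    by have [t Ntm] := Ncover m; exists (N t) => //; exists t.
  + rewrite card_eq_sym (card_eql (card_setT_finType T)) card_eq_sym.
    apply: inj_card_eq => t t' _ _ eqN.
    by apply: (sep (N t)) => //; rewrite eqN.
- move=> C [Cproper Ccover].
  have {}Ccover t : exists S, C S /\ S (x t).
    have : (\bigcup_(S in C) S) (x t) by rewrite Ccover.
    by case=> S CS Sx; exists S.
  have [g gP] := choice Ccover.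
  rewrite (card_le_eql (card_setT_finType T)).
  have gI : {in [set: T] &, injective g}.
    move=> t t' _ _ eqg; apply: (sep (g t)).
    - by apply: Cproper; case: (gP t).
    - by case: (gP t).
    - by rewrite eqg; case: (gP t').
  rewrite -(card_le_eql (inj_card_eq gI)).
  by apply: subset_card_le => _ [t _ <-]; case: (gP t).
Qed.

(** * Restriction of scalars *)

(** The alias keeps the new scalar action apart from the one [M] already has. *)
Definition restrict_scalars (R S : pzRingType) (f : {rmorphism S -> R})
  (M : lmodType R) : Type := M.

Section RestrictScalars.
Variables (R S : pzRingType) (f : {rmorphism S -> R}) (M : lmodType R).
Local Notation Mf := (restrict_scalars f M).

HB.instance Definition _ := GRing.Zmodule.on Mf.

Let scale (a : S) (u : Mf) : Mf := f a *: (u : M).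

Fact restrict_scaleA a b u : scale a (scale b u) = scale (a * b) u.
Proof. by rewrite /scale scalerA rmorphM. Qed.
Fact restrict_scale1 : left_id 1 scale.
Proof. by move=> u; rewrite /scale rmorph1 scale1r. Qed.
Fact restrict_scaleDr : right_distributive scale +%R.
Proof. by move=> a u v; rewrite /scale scalerDr. Qed.
Fact restrict_scaleDl u : {morph scale^~ u : a b / a + b}.
Proof. by move=> a b; rewrite /scale rmorphD scalerDl. Qed.

HB.instance Definition _ := GRing.Zmodule_isLmodule.Build S Mf
  restrict_scaleA restrict_scale1 restrict_scaleDr restrict_scaleDl.

Hypothesis fsurj : forall a, exists b, f b = a.

Lemma proper_submodule_restrict_scalars (N : set M) :
  proper_submodule (N : set Mf) <-> proper_submodule N.
Proof.
split=> -[[N0 Nlin] NT]; split=> //; split=> //.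
- by move=> a; have [b <-] := fsurj a; apply: Nlin.
- by move=> b; apply: (Nlin (f b)).
Qed.

Lemma covering_number_restrict_scalars k :
  covering_number_is M k -> covering_number_is Mf k.
Proof.
have coverP (C : set (set M)) : covering (C : set (set Mf)) <-> covering C.
  by split=> -[Cproper Ccover]; split=> // N CN;
    apply/proper_submodule_restrict_scalars/Cproper.
move=> [[C [Ccover Ck]] Cmin]; split.
- by exists C; split=> //; apply/coverP.
- by move=> D /coverP; apply: Cmin.
Qed.

End RestrictScalars.

(** * Lines and hyperplanes *)

Section Lines.
Variables (F : fieldType) (p : nat).
Implicit Types v w : 'rV[F]_p.

(** With [m < p] this says that every m x p matrix has its rows in some
    hyperplane. *)
Lemma orthogonal_vector m (A : 'M[F]_(m, p)) :
  ~~ row_full A -> exists2 v : 'rV_p, v != 0 & A *m v^T = 0.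
Proof.
move=> notfull; exists (nz_row (kermx A^T)).
  rewrite nz_row_eq0 -mxrank_eq0 mxrank_ker mxrank_tr subn_eq0.
  by rewrite col_leq_rank.
apply: trmx_inj; rewrite trmx_mul trmxK trmx0.
by apply/sub_kermxP/nz_row_sub.
Qed.

Lemma mulmx_tr_sub m (A : 'M[F]_(m, p)) v w :
  (w <= v)%MS -> A *m v^T = 0 -> A *m w^T = 0.
Proof.
by move=> /sub_rVP[a ->] Av; rewrite linearZ /= -scalemxAr Av scaler0.
Qed.

Lemma line_sub_sym v w : w != 0 -> (w <= v)%MS -> (v <= w)%MS.
Proof.
move=> w0 /sub_rVP[a Dw]; have a0 : a != 0.
  by apply: contraNneq w0 => a0; rewrite Dw a0 scale0r.
by rewrite Dw; apply/sub_rVP; exists a^-1; rewrite scalerA mulVf // scale1r.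
Qed.

End Lines.

(** The hyperplane orthogonal to [v] has dimension n, so a basis of it fits in
    the rows of A.  Its own orthogonal has dimension 1 and contains [v], so it
    is the line of [v]: this is how the row space of A determines the line. *)
Lemma hyperplane_basis (F : fieldType) n (v : 'rV[F]_n.+1) : v != 0 ->
  exists A : 'M[F]_(n, n.+1),
    A *m v^T = 0 /\ forall w : 'rV_n.+1, A *m w^T = 0 -> (w <= v)%MS.
Proof.
move=> v0; have rv : \rank v = 1%N by rewrite rank_rV v0.
pose K := kermx v^T.
have rK : \rank K = n by rewrite mxrank_ker mxrank_tr rv subn1.
have [A eqAK] : exists A : 'M[F]_(n, n.+1), (A :=: K)%MS.
  move: K rK => K rK.
  have [B eqBK] : exists B : 'M[F]_(\rank K, n.+1), (B :=: K)%MS.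
    by exists (row_base K); apply: eq_row_base.
  by rewrite rK in B eqBK; exists B.
have Av : A *m v^T = 0 by apply/sub_kermxP; rewrite eqAK.
have orthE (w : 'rV_n.+1) : A *m w^T = 0 -> (w <= kermx A^T)%MS.
  by move=> Aw; apply/sub_kermxP; apply: trmx_inj; rewrite trmx_mul !trmxK Aw trmx0.
exists A; split=> // w /orthE /submx_trans; apply.
have := mxrank_leqif_eq (orthE v Av).
rewrite rv mxrank_ker mxrank_tr eqAK rK subSnn => -[_].
by rewrite eqxx => /esym/andP[].
Qed.

Section CountLines.
Variables (F : finFieldType) (p : nat).

(** [<<v>>%MS] depends only on the row space of [v], so it is a canonical name
    for the line spanned by [v]. *)
Definition lines : {set 'M[F]_p} :=
  [set <<v>>%MS | v in [set~ (0 : 'rV[F]_p)]]%SET.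

(** Sending a nonzero vector to its line partitions the [#|F| ^ p - 1] nonzero
    vectors; the fibre over the line of [v] is in bijection with the nonzero
    scalars by [a |-> a *: v]. *)
Lemma card_lines : (#|lines| * (#|F| - 1) = #|F| ^ p - 1)%N.
Proof.
have <- : #|[set~ (0 : 'rV[F]_p)]%SET| = (#|F| ^ p - 1)%N.
  by rewrite cardsC1 card_mx mul1n subn1.
rewrite -[RHS]sum1_card (partition_big_imset (fun v : 'rV[F]_p => <<v>>%MS)) /=.
rewrite -sum_nat_const; apply: eq_bigr => _ /imsetP[v /[!inE] v0 ->].
have scaleI : injective (fun a : F => a *: v).
  by move=> a b /eqP; rewrite -subr_eq0 -scalerBl scaler_eq0 (negPf v0) orbF
    subr_eq0 => /eqP.
rewrite sum1_card subn1 -(cardsC1 (0 : F)) -(card_imset _ scaleI).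
apply: eq_card => w; rewrite [RHS]unfold_in !inE; apply/imsetP/andP => [[a]|[w0 /eqP/genmxP]].
- rewrite !inE => a0 ->{w}; have av0 : a *: v != 0.
    by rewrite scaler_eq0 negb_or a0.
  split=> //; apply/eqP/genmxP; rewrite scalemx_sub // line_sub_sym //.
  exact: scalemx_sub.
- case/andP=> /sub_rVP[a Dw] _; exists a => //.
  by rewrite !inE; apply: contraNneq w0 => a0; rewrite Dw a0 scale0r.
Qed.

End CountLines.

(** * The module of n x (n+1) matrices *)

(** An alias, because matrices already are a module over the scalars of F; here
    the square matrices act, by left multiplication. *)
Definition wide_matrix (F : fieldType) (n : nat) : Type := 'M[F]_(n, n.+1).

Section WideMatrix.
Variables (F : fieldType) (n : nat).
Local Notation W := (wide_matrix F n).

HB.instance Definition _ := GRing.Zmodule.on W.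

Let scale (B : 'M[F]_n) (A : W) : W := B *m (A : 'M_(n, n.+1)).

Fact wide_scaleA B C A : scale B (scale C A) = scale (B * C) A.
Proof. exact: mulmxA. Qed.
Fact wide_scale1 : left_id 1 scale.
Proof. exact: mul1mx. Qed.
Fact wide_scaleDr : right_distributive scale +%R.
Proof. exact: mulmxDr. Qed.
Fact wide_scaleDl A : {morph scale^~ A : B C / B + C}.
Proof. by move=> B C; apply: mulmxDl. Qed.

HB.instance Definition _ := GRing.Zmodule_isLmodule.Build 'M[F]_n W
  wide_scaleA wide_scale1 wide_scaleDr wide_scaleDl.

Definition rows_orthogonal_to (v : 'rV[F]_n.+1) : set W :=
  [set A | (A : 'M_(n, n.+1)) *m v^T = 0].

Lemma proper_rows_orthogonal_to (v : 'rV[F]_n.+1) : (0 < n)%N -> v != 0 ->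
  proper_submodule (rows_orthogonal_to v).
Proof.
move=> n_gt0 v0; split; first split.
- by rewrite inE /rows_orthogonal_to /= mul0mx.
- move=> B A1 A2; rewrite !inE /rows_orthogonal_to /= => A1v A2v.
  by rewrite mulmxDl -mulmxA A1v A2v mulmx0 addr0.
have [j vj] : exists j, v 0 j != 0.
  by apply/rV0Pn.
pose i0 := Ordinal n_gt0; move=> fullN.
have : rows_orthogonal_to v (delta_mx i0 j : 'M_(n, n.+1)) by rewrite fullN.
move=> /matrixP/(_ i0 0); rewrite mxE (bigD1 j) //= big1 => [|k kj].
  by rewrite !mxE !eqxx mul1r addr0; apply/eqP.
by rewrite !mxE (negPf kj) andbF mul0r.
Qed.

(** If the row spaces of [A1] and [A2] span F^(n+1), every matrix is
    [B1 *m A1 + B2 *m A2]. *)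
Lemma proper_submodule_not_full (S : set W) (A1 A2 : 'M[F]_(n, n.+1)) :
  proper_submodule S -> S A1 -> S A2 -> ~~ row_full (A1 + A2)%MS.
Proof.
move=> [[S0 Slin] Sproper] SA1 SA2; apply/negP => fullA; apply: Sproper.
apply/seteqP; split=> // X _.
have /sub_addsmxP[[B1 B2] /= ->] : ((X : 'M_(n, n.+1)) <= A1 + A2)%MS.
  exact: submx_full.
apply/set_mem; apply: (Slin B1); first exact/mem_set.
by rewrite -[_ *m A2]addr0; apply: (Slin B2) => //; apply/mem_set.
Qed.

End WideMatrix.

(** A line L stands for the hyperplane orthogonal to it, and its transversal
    element is a basis of that hyperplane, written as a matrix. *)
Lemma covering_number_wide_matrix (F : finFieldType) (n : nat) : (0 < n)%N ->
  covering_number_is (wide_matrix F n) #|lines F n.+1|.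
Proof.
move=> n_gt0; pose T := {L | L \in lines F n.+1}.
have vecP (L : T) : exists v : 'rV[F]_n.+1, v != 0 /\ val L = <<v>>%MS.
  by case: L => L /= /imsetP[v /[!inE] v0 ->]; exists v.
have [vec {}vecP] := choice vecP.
have /choice[x xP] (L : T) := hyperplane_basis (vecP L).1.
rewrite -[#|_|]card_sig.
apply: (@covering_number_of_transversal _ (wide_matrix F n) T
  (fun L => rows_orthogonal_to (vec L)) x).
- by move=> L; apply: proper_rows_orthogonal_to => //; case: (vecP L).
- move=> A; have [|v v0 Av] := @orthogonal_vector _ _ _ (A : 'M_(n, n.+1)).
    rewrite -col_leq_rank -ltnNge ltnS; exact: rank_leq_row.
  have vL : <<v>>%MS \in lines F n.+1 by apply/imsetP; exists v; rewrite ?inE.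
  pose L : T := exist (fun L => L \in lines F n.+1) _ vL; exists L; apply: mulmx_tr_sub Av.
  by have [_ /= /genmxP/andP[]] := vecP L.
- by move=> L; case: (xP L).
- move=> S Sproper L L' SL SL'.
  have [v v0] := orthogonal_vector (proper_submodule_not_full Sproper SL SL').
  (* A vector orthogonal to both hyperplanes spans both orthogonal lines. *)
  have lineE (K : T) : x K *m v^T = 0 -> val K = <<v>>%MS.
    move=> /(xP K).2 vK; rewrite (vecP K).2; apply/genmxP.
    by rewrite vK line_sub_sym.
  move=> sumv; apply: val_inj.
  have orth (A : 'M_(n, n.+1)) : (A <= x L + x L')%MS -> A *m v^T = 0.
    by move=> /submxP[B ->]; rewrite -mulmxA sumv mulmx0.
  by rewrite !lineE // orth // ?addsmxSl ?addsmxSr.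
Qed.

(** * Transposition as a ring morphism *)

Definition converse_trmx (F : fieldType) n (A : ('M[F]_n)^c) : 'M[F]_n :=
  (A : 'M[F]_n)^T.

Section ConverseTrmx.
Variables (F : fieldType) (n : nat).

Fact converse_trmx_is_zmod_morphism :
  zmod_morphism (@converse_trmx F n).
Proof. by move=> A B; apply: linearB. Qed.
Fact converse_trmx_is_monoid_morphism :
  monoid_morphism (@converse_trmx F n).
Proof. by split=> [|A B]; [apply: trmx1 | apply: trmx_mul]. Qed.

HB.instance Definition _ := GRing.isZmodMorphism.Build ('M[F]_n)^c 'M[F]_n
  (@converse_trmx F n) converse_trmx_is_zmod_morphism.
HB.instance Definition _ := GRing.isMonoidMorphism.Build ('M[F]_n)^c 'M[F]_n
  (@converse_trmx F n) converse_trmx_is_monoid_morphism.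

End ConverseTrmx.

Theorem corollary1p4 (q : nat) (hq : prime_power q)
    (F : finFieldType) (hF : #|F| = q) (n : nat) (hn : (1 <= n)%N) :
  (exists M : lmodType 'M[F]_n,
      covering_number_is M ((q ^ n.+1 - 1) %/ (q - 1))%N) /\
  (exists M : lmodType ('M[F]_n)^c,
      covering_number_is M ((q ^ n.+1 - 1) %/ (q - 1))%N).
Proof.
have -> : ((q ^ n.+1 - 1) %/ (q - 1))%N = #|lines F n.+1|.
  by rewrite -hF -card_lines mulnK // subn_gt0 card_finNzRing_gt1.
have left_cover := covering_number_wide_matrix F hn.
split; first by exists (wide_matrix F n).
exists (restrict_scalars (@converse_trmx F n) (wide_matrix F n)).
apply: covering_number_restrict_scalars left_cover => A.
by exists A^T; apply: trmxK.
Qed.
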